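(* Let $E_d,E_b,E_r$ be the independent log-normal energies and $s_I,K_I,d_I,\alpha_I$ the interference-link parameters defined in the context, and let $\mathsf{E}_B^{(m)}$ and $\mathsf{E}_R^{(m)}$ be the maximum transmit energies of the base station and of the relay, respectively. Let $I(x_I,y_I)$ be the average relay-generated interference (defined in the context) at a given neighboring user $M_I(x_I,y_I)$ located at distance $d_I$ from the relay station. Then $I(x_I,y_I)$ is lower-bounded by $$\widehat{I}(x_I,y_I)=\mathbb{E}\big[\widehat{E_r^{(\mathsf{RF})}}\big]\frac{\exp(\sigma_I^2/2)}{K_I d_I^{\alpha_I}}=\Big(\mathbb{P}_{\text{CR}}\;g(r,\mathsf{E}_R^{(m)})+\mathsf{E}_{\text{low}}^{(\text{I})}\Big)\frac{\exp(\sigma_I^2/2)}{K_I d_I^{\alpha_I}},$$ where $\mathbb{E}\big[\widehat{E_r^{(\mathsf{RF})}}\big]$ denotes $\mathbb{P}_{\text{CR}}\,g(r,\mathsf{E}_R^{(m)})+\mathsf{E}_{\text{low}}^{(\text{I})}$, with $\mathbb{P}_{\text{CR}}=\mathbb{P}(E_d>\mathsf{E}_B^{(m)})\,\mathbb{P}(E_b\le\mathsf{E}_B^{(m)})\,\mathbb{P}(E_r\le\mathsf{E}_R^{(m)})$, $$g(r,\mathsf{E})=e^{\mu_r+\sigma_r^2/2}\,\frac{\Phi\big(-\sigma_r+\frac{\ln\mathsf{E}-\mu_r}{\sigma_r}\big)}{\Phi\big(\frac{\ln\mathsf{E}-\mu_r}{\sigma_r}\big)},\qquad \mathsf{E}_{\text{low}}^{(\text{I})}=e^{\mu_r+\sigma_r^2/2}\big(\mathbb{P}_{\text{low}}^{(1,\text{I})}+\mathbb{P}_{\text{low}}^{(2,\text{I})}\big),$$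 $\Phi$ is the standard normal cumulative distribution function and, with $S=E_b+e^{\sigma_r^2}E_r$, $$\mathbb{P}_{\text{low}}^{(1,\text{I})}=\max\Big(0,\ \mathbb{P}(S\le E_d)-\Big[\mathbb{P}\big(\mathsf{E}_R^{(m)}\le E_d\le \mathsf{E}_B^{(m)}+\mathsf{E}_R^{(m)}\big)\,\mathbb{P}\big(S\le \mathsf{E}_B^{(m)}+\mathsf{E}_R^{(m)}\big)+\mathbb{P}\big(\mathsf{E}_B^{(m)}+\mathsf{E}_R^{(m)}\le E_d\big)\Big]\Big),$$ $$\mathbb{P}_{\text{low}}^{(2,\text{I})}=\mathbb{P}\big(\mathsf{E}_R^{(m)}\le E_d\le \mathsf{E}_B^{(m)}\big)\,\mathbb{P}\big(S\le \mathsf{E}_R^{(m)}\big).$$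
   Context: Setting: a base station (BS) sends data to a user either directly or in two hops through a relay station. The energies needed for the direct link ($d$), the BS-to-relay link ($b$) and the relay-to-user link ($r$) are $E_k=E_k^{(0)}/s_k$, $k\in\{d,b,r\}$, where the shadowing coefficients satisfy $\ln s_k\sim\mathcal{N}(0,\sigma_k^2)$, and the path-loss-only energies are the positive constants $E_d^{(0)}=(2^{\mathcal{R}}-1)N\gamma_d$, $E_b^{(0)}=(2^{2\mathcal{R}}-1)N\gamma_b/2$, $E_r^{(0)}=(2^{2\mathcal{R}}-1)N\gamma_r/2$, with $\mathcal{R}$ the user rate, $N$ the noise variance and $\gamma_d,\gamma_b,\gamma_r$ the path-losses. The link from the relay to the neighboring user, who is located in another cell, has path-loss $\gamma_I=K_I d_I^{\alpha_I}$ and shadowing $s_I$ with $\ln s_I\sim\mathcal{N}(0,\sigma_I^2)$. The coefficients $s_d,s_b,s_r,s_I$ are mutually independent. Thus $\ln E_k\sim\mathcal{N}(\mu_k,\sigma_k^2)$ with $\mu_k=\ln E_k^{(0)}$. No source of interference other than the relay is considered. The relay is used on two disjoint events: the coverage event $\mathcal{C}_{\text{CR}}=\{E_d>\mathsf{E}_B^{(m)}\}\cap\{E_b\le\mathsf{E}_B^{(m)}\}\cap\{E_r\le\mathsf{E}_R^{(m)}\}$ (of probability $\mathbb{P}_{\text{CR}}$) and the energy-efficiency event $\mathcal{C}_{\text{ER}}=\{E_d\le\mathsf{E}_B^{(m)}\}\cap\{E_b\le\mathsf{E}_B^{(m)}\}\cap\{E_r\le\mathsf{E}_R^{(m)}\}\cap\{E_b+E_r\le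 E_d\}$ (of probability $\mathbb{P}_{\text{ER}}$). The energy radiated by the relay, $E_r^{(\mathsf{RF})}$, equals $E_r$ on these events and $0$ otherwise, so its mean over $s_d,s_b,s_r$ is $\mathbb{E}[E_r^{(\mathsf{RF})}]=\mathbb{P}_{\text{CR}}\,\mathbb{E}[E_r\,|\,\mathcal{C}_{\text{CR}}]+\mathbb{P}_{\text{ER}}\,\mathbb{E}[E_r\,|\,\mathcal{C}_{\text{ER}}]$. The average interference is $I(x_I,y_I)=\mathbb{E}_{s_I}\big[\mathbb{E}[E_r^{(\mathsf{RF})}]\,s_I/\gamma_I\big]=\mathbb{E}[E_r^{(\mathsf{RF})}]\exp(\sigma_I^2/2)/(K_I d_I^{\alpha_I})$.
   Formalization: The formal theorem assumes the relay's maximum energy E_R^(m) is at most the base station's E_B^(m); without this the bound fails, e.g. as E_B^(m) tends to 0 and E_R^(m) to infinity, where P_low^(1,I) tends to P(S ≤ E_d) > 0. *)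

(* Defs.v *)
(* MathComp-Analysis, over an abstract R : realType. *)
From HB Require Import structures.
From mathcomp Require Import all_boot all_order all_algebra.
From mathcomp Require Import all_classical all_reals all_analysis.

Set Implicit Arguments.
Unset Strict Implicit.
Unset Printing Implicit Defensive.

Import Order.TTheory GRing.Theory Num.Theory.
Import numFieldNormedType.Exports.

Local Open Scope classical_set_scope.
Local Open Scope ring_scope.

(* Real-valued probability of an event; P is finite, so fine loses nothing. *)
Definition Pr d (T : measurableType d) (R : realType) (P : probability T R)
  (A : set T) : R := fine (P A).

Definition mutually_independent d (T : measurableType d) (R : realType)
    (P : probability T R) (n : nat) (X : 'I_n -> {RV P >-> R}) : Prop :=
  forall (J : {set 'I_n}) (A : 'I_n -> set R),
    (forall i, measurable (A i)) ->
    P (\bigcap_(i in [set` J]) (X i @^-1` A i)) =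
    (\prod_(i in J) P (X i @^-1` A i))%E.

(* s > 0 and ln s ~ N(0, sigma^2).  The second argument of normal_prob is the
   standard deviation; at 0 the library's normal_prob is not a Dirac mass, so
   this is only meaningful for sigma != 0. *)
Definition lognormal_shadowing d (T : measurableType d) (R : realType)
    (P : probability T R) (s : {RV P >-> R}) (sigma : R) : Prop :=
  (forall t, 0 < s t) /\
  (forall A : set R, measurable A ->
     pushforward P (fun t => ln (s t)) A = normal_prob 0 sigma A).

(* Path-loss-only energies: one-hop transmission, and each of the two
   half-duration hops of the relayed transmission. *)
Definition direct_energy0 (R : realType) (rate N gamma : R) : R :=
  (2 `^ rate - 1) * N * gamma.

Definition hop_energy0 (R : realType) (rate N gamma : R) : R :=
  (2 `^ (2 * rate) - 1) * N * gamma / 2.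

Definition link_energy (T : Type) (R : realType) (E0 : R) (s : T -> R) : T -> R :=
  fun t => E0 / s t.

Definition path_loss (R : realType) (K dist alpha : R) : R := K * dist `^ alpha.

Definition coverage_event (T : Type) (R : realType) (Ed Eb Er : T -> R)
    (EBm ERm : R) : set T :=
  [set t | Ed t > EBm] `&` [set t | Eb t <= EBm] `&` [set t | Er t <= ERm].

Definition efficiency_event (T : Type) (R : realType) (Ed Eb Er : T -> R)
    (EBm ERm : R) : set T :=
  [set t | Ed t <= EBm] `&` [set t | Eb t <= EBm] `&` [set t | Er t <= ERm] `&`
  [set t | Eb t + Er t <= Ed t].

(* Energy radiated by the relay: Er on the two events, 0 elsewhere. *)
Definition relay_RF_energy (T : Type) (R : realType) (Ed Eb Er : T -> R)
    (EBm ERm : R) : T -> R :=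
  Er \_ (coverage_event Ed Eb Er EBm ERm `|` efficiency_event Ed Eb Er EBm ERm).

(* E_{s_I}[ E[Erf] * s_I / gamma_I ], as an extended real. *)
Definition average_interference d (T : measurableType d) (R : realType)
    (P : probability T R) (Erf sI : T -> R) (gammaI : R) : \bar R :=
  (\int[P]_t ('E_P[Erf] * (sI t / gammaI)%:E))%E.

Definition Phi (R : realType) (x : R) : R :=
  fine (normal_prob (0 : R) 1 `]-oo, x]).

Definition g_mean (R : realType) (mu sigma E : R) : R :=
  expR (mu + sigma ^+ 2 / 2) *
  (Phi (- sigma + (ln E - mu) / sigma) / Phi ((ln E - mu) / sigma)).

Section LowerBound.
Context d (T : measurableType d) (R : realType) (P : probability T R).
Variables (Ed Eb Er : T -> R) (mur sigmar EBm ERm : R).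

Definition weighted_sum : T -> R := fun t => Eb t + expR (sigmar ^+ 2) * Er t.

Definition P_low1 : R :=
  Num.max 0
    (Pr P [set t | weighted_sum t <= Ed t] -
     (Pr P [set t | ERm <= Ed t <= EBm + ERm] *
        Pr P [set t | weighted_sum t <= EBm + ERm] +
      Pr P [set t | EBm + ERm <= Ed t])).

Definition P_low2 : R :=
  Pr P [set t | ERm <= Ed t <= EBm] * Pr P [set t | weighted_sum t <= ERm].

Definition E_low : R := expR (mur + sigmar ^+ 2 / 2) * (P_low1 + P_low2).

Definition mean_RF_lower : R :=
  Pr P (coverage_event Ed Eb Er EBm ERm) * g_mean mur sigmar ERm + E_low.

End LowerBound.

(* Main.v *)
Require Import Defs.
From HB Require Import structures.
From mathcomp Require Import all_boot all_order all_algebra.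
From mathcomp Require Import all_classical all_reals all_analysis.
From mathcomp Require Import measurable_realfun.
From mathcomp Require Import ring lra.

(* Tilting a log-normal variable s with ln s ~ N(0, sigma^2) by the density s^c
multiplies it by exp(c sigma^2), up to the constant exp(c^2 sigma^2 / 2).  With
c = -1 and s = s_r, independence turns the mean radiated energy into
exp(mu_r + sigma_r^2 / 2) times the probability of the coverage or efficiency
event in which E_r is replaced by W = exp(sigma_r^2) E_r.  The coverage event
gives P_CR g exactly.  Since S = E_b + W <= E_d <= E_B forces E_b <= E_B, the
efficiency event contains the two disjoint events {S <= E_d < E_R} and
{E_R <= E_d <= E_B, S <= E_R}: the probability of the second one is P_low^(2), and
that of the first one is at least P_low^(1), by a union bound on {S <= E_d}. *)

Import Order.TTheory GRing.Theory Num.Theory.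
Import numFieldNormedType.Exports.

Local Open Scope classical_set_scope.
Local Open Scope ring_scope.

(** * Change of variables and densities *)

Lemma measurable_affine {R : realType} (a b : R) :
  measurable_fun [set: R] (fun x => a * x + b : measurableTypeR R).
Proof.
apply: (@measurable_funD _ _ R setT (fun x => a * x) (cst b)) => //.
exact: (@measurable_funM _ _ R setT (cst a) id).
Qed.

Lemma affine_preimage_itvoc {R : realType} (a b u v : R) : 0 < a ->
  (fun x => a * x + b) @^-1` `]u, v]%classic =
  `](u - b) / a, (v - b) / a]%classic.
Proof.
move=> a0; apply/seteqP; split => x; rewrite /= !in_itv/=;
  by rewrite ltr_pdivrMr// ler_pdivlMr// mulrC ltrBlDr lerBrDr.
Qed.

(** Both sides are measures in [A] and agree on half-open intervals, which determine Lebesgue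
    measure. *)
Lemma lebesgue_measure_affine {R : realType} (a b : R) (A : set R) :
  0 < a -> measurable A ->
  lebesgue_measure A =
  (a%:E * lebesgue_measure ((fun x => (a * x + b)%R) @^-1` A))%E.
Proof.
move=> a0 mA.
pose m := mscale (NngNum (ltW a0))
  (pushforward lebesgue_measure (fun x => a * x + b : measurableTypeR R)).
have maff := @measurable_affine R a b.
rewrite (@lebesgue_measure_unique R (m maff))// => _ [[u v]] _ <-.
change (lebesgue_measure `]u, v]%classic =
  (a%:E * lebesgue_measure ((fun x => (a * x + b)%R) @^-1` `]u, v]%classic))%E).
rewrite affine_preimage_itvoc//.
rewrite !lebesgue_measure_itv/= !lte_fin ltr_pM2r ?invr_gt0// ltrD2r.
case: ifP => _; last by rewrite mule0.
rewrite -!EFinB -EFinM; congr EFin.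
by rewrite -mulrBl mulrC divfK ?gt_eqF// opprD addrACA subrr addr0.
Qed.


Lemma ge0_integral_affine {R : realType} (a b : R) (f : R -> \bar R) :
  0 < a -> measurable_fun [set: R] f -> (forall x, 0 <= f x)%E ->
  (\int[lebesgue_measure]_x f x =
   a%:E * \int[lebesgue_measure]_x f (a * x + b)%R)%E.
Proof.
move=> a0 mf f0.
have maff := @measurable_affine R a b.
pose m := mscale (NngNum (ltW a0))
  (pushforward lebesgue_measure (fun x => a * x + b : measurableTypeR R)).
rewrite (eq_measure_integral (m maff)); last first.
  by move=> A mA _; exact: lebesgue_measure_affine.
rewrite /m ge0_integral_mscale//=; congr (_ * _)%E.
by rewrite ge0_integral_pushforward.
Qed.

Lemma ge0_integral_oppr {R : realType} (f : R -> \bar R) :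
  measurable_fun [set: R] f -> (forall x, 0 <= f x)%E ->
  (\int[lebesgue_measure]_x f x = \int[lebesgue_measure]_x f (- x)%R)%E.
Proof.
move=> mf f0.
have mopp : measurable_fun [set: R] (fun x : R => (- x)%R : measurableTypeR R).
  exact: oppr_measurable.
rewrite (eq_measure_integral
    (pushforward lebesgue_measure (-%R : R -> measurableTypeR R))); last first.
  by move=> A mA _; exact/esym/lebesgue_measureN.
by rewrite ge0_integral_pushforward.
Qed.


Section density.
Import HBNNSimple.

(** Monotone convergence reduces both sides to simple functions, and linearity to indicators, where
    the equality is the hypothesis on [nu]. *)
Lemma ge0_integral_density d (T : measurableType d) (R : realType)
    (mu nu : {measure set T -> \bar R}) (g : T -> R) (f : T -> \bar R) :
  measurable_fun setT g -> (forall x, 0 <= g x) ->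
  (forall A, measurable A -> nu A = \int[mu]_(x in A) (g x)%:E)%E ->
  measurable_fun setT f -> (forall x, 0 <= f x)%E ->
  (\int[nu]_x f x = \int[mu]_x ((g x)%:E * f x))%E.
Proof.
move=> mg g0 nuE mf f0.
have mgE : measurable_fun setT (EFin \o g) by exact/measurable_EFinP.
pose f_ := nnsfun_approx measurableT mf.
transitivity (limn (fun n => \int[nu]_x (f_ n x)%:E)%E).
  rewrite -monotone_convergence//.
  - by apply: eq_integral => y _; apply/esym/cvg_lim => //;
      apply: cvg_nnsfun_approx.
  - by move=> n; exact/measurable_EFinP/measurable_funP.
  - by move=> n y _; rewrite lee_fin.
  - by move=> y _ m n mn; rewrite lee_fin; exact/lefP/nd_nnsfun_approx.
transitivity (limn (fun n => \int[mu]_x ((g x)%:E * (f_ n x)%:E))%E); last first.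
  rewrite -monotone_convergence//.
  - apply: eq_integral => y _; apply/cvg_lim => //.
    by apply: cvgeZl => //; apply: cvg_nnsfun_approx.
  - move=> n; apply: emeasurable_funM => //.
    exact/measurable_EFinP/measurable_funP.
  - by move=> n y _; rewrite -EFinM lee_fin mulr_ge0.
  - move=> y _ m n mn; rewrite -!EFinM lee_fin ler_wpM2l//.
    exact/lefP/nd_nnsfun_approx.
congr (limn _); apply/funext => n.
have mpre r : measurable (f_ n @^-1` [set r]) by [].
under [LHS]eq_integral do rewrite fimfunE -fsumEFin//.
rewrite ge0_integral_fsum//; last 2 first.
- by move=> y; exact/measurable_EFinP/measurable_funM.
- by move=> y x _; rewrite nnfun_muleindic_ge0.
rewrite [RHS](eq_integral (fun x =>
    \sum_(r \in range (f_ n)) (g x)%:E * (r * \1_(f_ n @^-1` [set r]) x)%:E)%E); last first.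
  move=> x _; rewrite fimfunE -fsumEFin// ge0_mule_fsumr// => r.
  exact: nnfun_muleindic_ge0.
rewrite ge0_integral_fsum//; last 2 first.
- move=> r; apply: emeasurable_funM => //.
  by apply/measurable_EFinP/measurable_funM.
- by move=> r x _; apply: mule_ge0; [rewrite lee_fin|exact: nnfun_muleindic_ge0].
apply: eq_fsbigr => r _; rewrite integralZl_indic_nnsfun// integral_indic// setIT nuE//.
(* A nonnegative simple function takes no negative value, so for [r < 0] the level set is empty and
   both sides vanish; for [r >= 0] the scalar can enter the integral. *)
have [r0|r0] := leP 0 r; last first.
  rewrite preimage_nnfun0// integral_set0 mule0 integral0_eq// => x _.
  by rewrite indic0 mulr0 mule0.
rewrite integral_mkcond -ge0_integralZl//; last 2 first.
- by apply/(measurable_restrictT _ (mpre r)).1; exact: measurable_funTS.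
- by move=> x _; apply: erestrict_ge0 => y _; rewrite lee_fin.
apply: eq_integral => x _; rewrite patchE indicE.
by case: ifPn => _; rewrite ?mulr1 ?mulr0 ?mule0// muleC.
Qed.

End density.

(** * Gaussian and log-normal tilting *)

Lemma ge0_integral_normal_prob {R : realType} (m s : R) (f : R -> \bar R) :
  measurable_fun [set: R] f -> (forall x, 0 <= f x)%E ->
  (\int[normal_prob m s]_x f x =
   \int[lebesgue_measure]_x ((normal_pdf m s x)%:E * f x))%E.
Proof.
move=> mf f0.
apply: (@ge0_integral_density _ (measurableTypeR R) R lebesgue_measure) => //.
- exact: measurable_normal_pdf.
- by move=> x; exact: normal_pdf_ge0.
Qed.

Lemma normal_pdfE0 {R : realType} (m s x : R) : s != 0 ->
  normal_pdf m s x = normal_peak s * normal_fun m s x.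
Proof. by move=> s0; rewrite normal_pdfE. Qed.

(** Completing the square: -(x + c s^2)^2 / (2 s^2) + c (x + c s^2) = c^2 s^2 / 2 - x^2 / (2
    s^2). *)
Lemma normal_pdf_tilt {R : realType} (s c x : R) : s != 0 ->
  normal_pdf 0 s (x + c * s ^+ 2) * expR (c * (x + c * s ^+ 2)) =
  expR (c ^+ 2 * s ^+ 2 / 2) * normal_pdf 0 s x.
Proof.
move=> s0; rewrite !normal_pdfE0// /normal_fun !subr0.
rewrite -[LHS]mulrA -expRD [RHS]mulrCA -expRD; congr (_ * expR _).
by field.
Qed.

(** Exponential tilting moves the mean of a centred Gaussian to c s^2: write both sides against
    Lebesgue measure and translate the variable by that amount. *)
Lemma integral_normal_prob_tilt {R : realType} (s c : R) (f : R -> \bar R) :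
  s != 0 -> measurable_fun [set: R] f -> (forall x, 0 <= f x)%E ->
  (\int[normal_prob 0%R s]_x ((expR (c * x))%:E * f x) =
   (expR (c ^+ 2 * s ^+ 2 / 2))%:E *
   \int[normal_prob 0%R s]_x f (x + c * s ^+ 2)%R)%E.
Proof.
move=> s0 mf f0.
have mexp : measurable_fun [set: R] (fun x => (expR (c * x))%:E).
  apply/measurable_EFinP/(measurableT_comp (@measurable_expR R)).
  exact: measurable_funM.
have mpdf : measurable_fun [set: R] (fun x => (normal_pdf 0 s x)%:E).
  by apply/measurable_EFinP; exact: measurable_normal_pdf.
have mshift : measurable_fun [set: R] (fun x => f (x + c * s ^+ 2)%R).
  by apply: measurableT_comp => //; exact: measurable_funD.
rewrite !ge0_integral_normal_prob//; last 2 first.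
- exact: emeasurable_funM.
- by move=> x; rewrite mule_ge0// lee_fin expR_ge0.
rewrite (ge0_integral_affine _ (c * s ^+ 2) _ ltr01)//; last 2 first.
- by apply: emeasurable_funM => //; exact: emeasurable_funM.
- by move=> x; rewrite !mule_ge0// lee_fin ?expR_ge0 ?normal_pdf_ge0.
rewrite mul1e -ge0_integralZl//; last 2 first.
- exact: emeasurable_funM.
- by move=> x _; rewrite mule_ge0// lee_fin normal_pdf_ge0.
apply: eq_integral => x _.
by rewrite mul1r muleA -EFinM normal_pdf_tilt// EFinM muleA.
Qed.

Lemma normal_pdf_scale {R : realType} (s x : R) : 0 < s ->
  s * normal_pdf 0 s (- (s * x)) = normal_pdf 0 1 x.
Proof.
move=> s0; rewrite !normal_pdfE0 ?gt_eqF// /normal_fun !subr0 mulrA.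
congr (_ * expR _); last by field; rewrite gt_eqF.
rewrite /normal_peak -!mulrnAr sqrtrM ?sqr_ge0// sqrtr_sqr gtr0_norm//.
by rewrite expr1n mul1r invfM mulrA divff ?gt_eqF// mul1r.
Qed.

(** If Z is standard normal then -s Z has law N(0, s^2). The reflection is included so that upper
    tails become lower tails, hence values of [Phi]. *)
Lemma normal_prob_scale {R : realType} (s : R) (A : set R) : 0 < s ->
  measurable A ->
  normal_prob 0 s A = normal_prob 0 1 ((fun x => - (s * x)) @^-1` A).
Proof.
move=> s0 mA; rewrite /normal_prob.
have mpdf (t : R) : measurable_fun [set: R] (fun x => (normal_pdf 0 t x)%:E).
  by apply/measurable_EFinP; exact: measurable_normal_pdf.
have mres : measurable_fun [set: R] ((fun x => (normal_pdf 0 s x)%:E) \_ A).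
  apply: (iffLR (measurable_restrictT _ mA)).
  exact: measurable_funTS.
have res0 x : (0 <= ((fun x => (normal_pdf 0 s x)%:E) \_ A) x)%E.
  by apply: erestrict_ge0 => y _; rewrite lee_fin normal_pdf_ge0.
rewrite [LHS]integral_mkcond [RHS]integral_mkcond ge0_integral_oppr//.
rewrite (ge0_integral_affine _ 0 _ s0)//; last first.
  by apply: measurableT_comp => //; exact: oppr_measurable.
rewrite -ge0_integralZl//; last 2 first.
- apply: (measurableT_comp mres) => //; apply: measurableT_comp => //.
  exact: measurable_affine.
- by rewrite lee_fin ltW.
apply: eq_integral => x _; rewrite addr0 !patchE /=.
have -> : (x \in (fun x => - (s * x)) @^-1` A) = (- (s * x) \in A).
  by apply/idP/idP; rewrite !inE.
case: ifPn => // _; last by rewrite mule0.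
by rewrite -EFinM normal_pdf_scale.
Qed.

Lemma normal_prob_itvcy {R : realType} (s a : R) : 0 < s ->
  fine (normal_prob 0 s `[a, +oo[%classic) = Phi (- a / s).
Proof.
move=> s0; rewrite /Phi normal_prob_scale//; congr (fine (normal_prob _ _ _)).
apply/seteqP; split => x /=; rewrite !in_itv/= andbT => h.
  by rewrite ler_pdivlMr// mulrC lerNr.
by move: h; rewrite ler_pdivlMr// mulrC lerNr.
Qed.

(** * Log-normal variables: integrals, tilting and distribution function *)

Section lognormal.
Context {d} {T : measurableType d} {R : realType} {P : probability T R}.
Context {s : {RV P >-> R}} {sigma : R}.
Hypothesis hs : lognormal_shadowing s sigma.
Hypothesis sigma_gt0 : 0 < sigma.

Lemma measurable_ln_RV : measurable_fun [set: T] (fun t => ln (s t) : measurableTypeR R).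
Proof. exact: (measurableT_comp (@measurable_ln R)). Qed.

(** Since s > 0, g(s) = g(exp(ln s)), and the law of ln s is the given Gaussian. *)
Lemma ge0_integral_lognormal (g : R -> \bar R) :
  measurable_fun [set: R] g -> (forall x, 0 <= g x)%E ->
  (\int[P]_t g (s t) = \int[normal_prob 0%R sigma]_x g (expR x))%E.
Proof.
move=> mg g0; have mln := measurable_ln_RV.
have mge : measurable_fun [set: R] (g \o expR).
  by apply: measurableT_comp => //; exact: measurable_expR.
transitivity (\int[P]_t ((g \o expR) \o (fun t => ln (s t))) t)%E.
  by apply: eq_integral => t _ /=; rewrite lnK// posrE; exact: hs.1.
rewrite -[LHS](@ge0_integral_pushforward _ _ _ _ _ _ mln P setT (g \o expR))//;
  last by move=> y _; exact: g0.
by apply: eq_measure_integral => A mA _; exact: hs.2.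
Qed.

(** With x = ln s the weight s^c is exp(c x), and translating x by c sigma^2 multiplies s by exp(c
    sigma^2), so this is the Gaussian tilt in multiplicative form. *)
Lemma lognormal_tilt (c : R) (g : R -> \bar R) :
  measurable_fun [set: R] g -> (forall x, 0 <= g x)%E ->
  (\int[P]_t ((s t `^ c)%:E * g (s t)) =
   (expR (c ^+ 2 * sigma ^+ 2 / 2))%:E *
   \int[P]_t g (s t * expR (c * sigma ^+ 2))%R)%E.
Proof.
move=> mg g0.
have mgs : measurable_fun [set: R] (fun x => g (x * expR (c * sigma ^+ 2))).
  by apply: (measurableT_comp mg); exact: measurable_funM.
rewrite (ge0_integral_lognormal (fun x => (x `^ c)%:E * g x)%E); last 2 first.
- apply: emeasurable_funM => //; apply/measurable_EFinP.
  exact: measurable_powR.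
- by move=> x; rewrite mule_ge0// lee_fin powR_ge0.
rewrite (ge0_integral_lognormal (fun x => g (x * expR (c * sigma ^+ 2))%R))//.
under [X in (_ = _ * X)%E]eq_integral do rewrite -expRD.
rewrite -(@integral_normal_prob_tilt _ _ _ (g \o expR)) ?gt_eqF//; last 2 first.
- by apply: measurableT_comp => //; exact: measurable_expR.
- by move=> x; exact: g0.
by apply: eq_integral => x _; rewrite /powR gt_eqF ?expR_gt0// expRK.
Qed.

(** Because s is in the denominator, E0 / s <= E is the upper tail ln s >= ln E0 - ln E. *)
Lemma lognormal_link_cdf (E0 E : R) : 0 < E0 -> 0 < E ->
  Pr P [set t | link_energy E0 s t <= E] = Phi ((ln E - ln E0) / sigma).
Proof.
move=> E00 E_gt0; rewrite /Pr.
rewrite (_ : [set t | _] = (fun t => ln (s t)) @^-1` `[ln E0 - ln E, +oo[%classic).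
  rewrite [P _](hs.2 (`[_, +oo[%classic))// normal_prob_itvcy//.
  by rewrite opprB.
apply/seteqP; split => t /=; rewrite /link_energy in_itv/= andbT;
  have st := hs.1 t.
  rewrite -ler_ln ?posrE ?divr_gt0// ln_div ?posrE//; lra.
move=> h; rewrite -ler_ln ?posrE ?divr_gt0// ln_div ?posrE//; lra.
Qed.

End lognormal.

(** * Independence *)

(** The values lie in arbitrary measurable spaces, so that one of the two variables can itself be a
    pair. *)
Definition independent_RV {d d1 d2} {T : measurableType d} {T1 : measurableType d1}
    {T2 : measurableType d2} {R : realType} (P : probability T R)
    (X : T -> T1) (Y : T -> T2) : Prop :=
  forall A B, measurable A -> measurable B ->
    P (X @^-1` A `&` Y @^-1` B) = (P (X @^-1` A) * P (Y @^-1` B))%E.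

(** Named so that it can carry a measurable-function structure and hence have a [distribution]. *)
Definition pair_RV {d d1 d2} {T : measurableType d} {T1 : measurableType d1}
    {T2 : measurableType d2} (X : T -> T1) (Y : T -> T2) : T -> T1 * T2 :=
  fun t => (X t, Y t).

Section pair_RV_measurable.
Context {d d1 d2} {T : measurableType d} {T1 : measurableType d1}
  {T2 : measurableType d2}.
Variables (X : {mfun T >-> T1}) (Y : {mfun T >-> T2}).

Lemma measurable_pair_RV : measurable_fun [set: T] (pair_RV X Y).
Proof. exact: measurable_fun_pair. Qed.

HB.instance Definition _ := isMeasurableFun.Build _ _ _ _ (pair_RV X Y)
  measurable_pair_RV.

End pair_RV_measurable.

Section independence.
Context {d d1 d2} {T : measurableType d} {T1 : measurableType d1}
  {T2 : measurableType d2} {R : realType} (P : probability T R).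
Variables (X : {mfun T >-> T1}) (Y : {mfun T >-> T2}).
Hypothesis indXY : independent_RV P X Y.

(** Independence is the equality on rectangles, and a product measure is determined by its values
    there. *)
Lemma distribution_pair_RV (A : set (T1 * T2)) : measurable A ->
  distribution P (pair_RV X Y) A =
  (distribution P X \x distribution P Y)%E A.
Proof.
by move=> mA; apply/esym/product_measure_unique.
Qed.

(** Tonelli for the product of the two laws; the inner integral is then carried back from the law of
    [Y] to [P]. *)
Lemma independent_integral (f : T1 * T2 -> \bar R) :
  measurable_fun [set: T1 * T2] f -> (forall z, 0 <= f z)%E ->
  (\int[P]_t f (X t, Y t) =
   \int[distribution P X]_x \int[P]_t f (x, Y t))%E.
Proof.
move=> mf f0.
rewrite -[LHS](@ge0_integral_distribution _ _ _ _ _ P (pair_RV X Y) f mf f0).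
rewrite (eq_measure_integral (distribution P X \x distribution P Y)%E); last first.
  by move=> A mA _; exact: distribution_pair_RV.
rewrite fubini_tonelli1//; apply: eq_integral => x _.
rewrite /fubini_F ge0_integral_distribution//.
exact: measurable_fun_pair2.
Qed.

End independence.

Lemma independent_pairr {d d1 d2 d3} {T : measurableType d}
    {T1 : measurableType d1} {T2 : measurableType d2} {T3 : measurableType d3}
    {R : realType} (P : probability T R)
    (X : {mfun T >-> T1}) (Y : {mfun T >-> T2}) (Z : {mfun T >-> T3}) :
  (forall A B C, measurable A -> measurable B -> measurable C ->
    P (X @^-1` A `&` Y @^-1` B `&` Z @^-1` C) =
    (P (X @^-1` A) * P (Y @^-1` B) * P (Z @^-1` C))%E) ->
  independent_RV P X (pair_RV Y Z).
Proof.
move=> ind A B mA mB.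
have indYZ : independent_RV P Y Z.
  move=> C D mC mD; have := ind setT C D measurableT mC mD.
  by rewrite preimage_setT setTI probability_setT mul1e.
have mXA : measurable (X @^-1` A) by exact: measurable_funPTI.
have pf : P (X @^-1` A) \is a fin_num by exact: fin_num_measure.
have p0 : 0 <= fine (P (X @^-1` A)) by exact: fine_ge0.
(* Restricting P to X @^-1` A, or scaling it by P (X @^-1` A), gives the same
   law of (Y, Z) on rectangles, hence on every measurable B. *)
pose m1 := mscale (NngNum p0) (distribution P Y).
have mYZ := measurable_pair_RV Y Z.
have e1 : (m1 \x distribution P Z)%E B =
    pushforward (mrestr P mXA) (pair_RV Y Z) B.
  apply: product_measure_unique => // C D mC mD.
  transitivity (P (X @^-1` A `&` Y @^-1` C `&` Z @^-1` D)).
    by rewrite /= /pushforward /mrestr; congr (P _); rewrite setIC setIA.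
  by rewrite ind// /m1 /= /mscale/= fineK.
have e2 : (m1 \x distribution P Z)%E B =
    (P (X @^-1` A) * P (pair_RV Y Z @^-1` B))%E.
  transitivity (mscale (NngNum p0) (distribution P (pair_RV Y Z)) B).
    apply: product_measure_unique => // C D mC mD.
    rewrite /m1 /= /mscale/= -muleA; congr (_ * _)%E.
    exact: indYZ.
  by rewrite /mscale/= fineK.
by rewrite setIC -e2 e1.
Qed.

(** * Events and their probabilities *)

Lemma measurable_invr {R : realType} : measurable_fun [set: R] (@GRing.inv R).
Proof.
(* Unlike x `^ (-1), this form agrees with x^-1 for negative x, and at 0. *)
rewrite (_ : GRing.inv = fun x : R => x * (x ^+ 2) `^ (-1)).
  apply: measurable_funM => //.
  apply: (@measurableT_comp _ _ _ _ _ _ (@powR R ^~ (-1))).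
    exact: measurable_powR.
  exact: measurable_funX.
apply/funext => x; rewrite powR_inv1 ?sqr_ge0//.
have [->|x0] := eqVneq x 0; first by rewrite invr0 mul0r.
by field.
Qed.

Lemma measurable_link_energy {d} {T : measurableType d} {R : realType} (E0 : R)
    (s : T -> R) :
  measurable_fun setT s -> measurable_fun setT (link_energy E0 s).
Proof.
move=> ms; apply: measurable_funM => //.
exact: (measurableT_comp measurable_invr).
Qed.

Section events.
Context {d} {T : measurableType d} {R : realType}.
Implicit Types f g : T -> R.

Lemma measurable_set_le f g : measurable_fun setT f -> measurable_fun setT g ->
  measurable [set t | f t <= g t].
Proof. by move=> mf mg; rewrite -[X in measurable X]setTI; exact: measurable_fun_le. Qed.

Lemma measurable_set_lt f g : measurable_fun setT f -> measurable_fun setT g ->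
  measurable [set t | f t < g t].
Proof.
move=> mf mg; rewrite (_ : [set t | _] = ~` [set t | g t <= f t]).
  by apply: measurableC; exact: measurable_set_le.
by apply/seteqP; split => t /=; rewrite ltNge => /negP.
Qed.

Lemma measurable_set_le_le f (a b : R) : measurable_fun setT f ->
  measurable [set t | a <= f t <= b].
Proof.
move=> mf; rewrite (_ : [set t | _] = [set t | a <= f t] `&` [set t | f t <= b]).
  by apply: measurableI; apply: measurable_set_le.
by apply/seteqP; split => t /= => [/andP[]//|[-> ->]].
Qed.

Variables (Ed Eb Er : T -> R) (EBm ERm : R).
Hypotheses (mEd : measurable_fun setT Ed) (mEb : measurable_fun setT Eb)
  (mEr : measurable_fun setT Er).

Lemma measurable_coverage_event :
  measurable (coverage_event Ed Eb Er EBm ERm).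
Proof.
apply: measurableI; [apply: measurableI|]; last exact: measurable_set_le.
- exact: measurable_set_lt.
- exact: measurable_set_le.
Qed.

Lemma measurable_efficiency_event :
  measurable (efficiency_event Ed Eb Er EBm ERm).
Proof.
apply: measurableI; [apply: measurableI; [apply: measurableI|]|];
  apply: measurable_set_le => //.
exact: measurable_funD.
Qed.

Lemma coverage_efficiency_disjoint :
  coverage_event Ed Eb Er EBm ERm `&` efficiency_event Ed Eb Er EBm ERm = set0.
Proof.
apply/seteqP; split => // t [[[/= h _] _] [[[/= h' _] _] _]].
by move: (lt_le_trans h h'); rewrite ltxx.
Qed.

End events.

Section Pr_lemmas.
Context {d} {T : measurableType d} {R : realType} (P : probability T R).
Implicit Types A B : set T.

Lemma EFin_Pr A : measurable A -> (Pr P A)%:E = P A.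
Proof. by move=> mA; rewrite /Pr fineK// fin_num_measure. Qed.

Lemma Pr_ge0 A : 0 <= Pr P A.
Proof. exact: fine_ge0. Qed.

Lemma le_Pr A B : measurable A -> measurable B -> A `<=` B -> Pr P A <= Pr P B.
Proof.
by move=> mA mB AB; rewrite -lee_fin !EFin_Pr// le_measure// inE.
Qed.

Lemma PrU_le A B : measurable A -> measurable B ->
  Pr P (A `|` B) <= Pr P A + Pr P B.
Proof.
move=> mA mB; rewrite -lee_fin EFinD !EFin_Pr//; last exact: measurableU.
exact: measureU2.
Qed.

Lemma PrU A B : measurable A -> measurable B -> A `&` B = set0 ->
  Pr P (A `|` B) = Pr P A + Pr P B.
Proof.
move=> mA mB AB; apply: EFin_inj; rewrite EFinD !EFin_Pr//; last exact: measurableU.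
exact: measureU.
Qed.

End Pr_lemmas.

(** * Lower bound for the tilted efficiency event *)

Section efficiency_bound.
Context {d} {T : measurableType d} {R : realType} (P : probability T R).
Variables (Ed Eb Er : T -> R) (sigmar EBm ERm : R).
Hypotheses (mEd : measurable_fun setT Ed) (mEb : measurable_fun setT Eb)
  (mEr : measurable_fun setT Er).
Hypotheses (Eb_gt0 : forall t, 0 < Eb t) (Er_gt0 : forall t, 0 < Er t).
Let S := weighted_sum Eb Er sigmar.
Let W : T -> R := fun t => expR (sigmar ^+ 2) * Er t.
Hypothesis ind : forall a b c, Pr P ([set t | a <= Ed t <= b] `&` [set t | S t <= c]) =
  Pr P [set t | a <= Ed t <= b] * Pr P [set t | S t <= c].

Lemma efficiency_event_lower_bound : ERm <= EBm ->
  P_low1 P Ed Eb Er sigmar EBm ERm + P_low2 P Ed Eb Er sigmar EBm ERm <=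
  Pr P (efficiency_event Ed Eb W EBm ERm).
Proof.
move=> ERB; have W0 t : 0 < W t by rewrite mulr_gt0 ?expR_gt0.
have SE t : S t = Eb t + W t by [].
have mW : measurable_fun setT W by exact: measurable_funM.
have mS : measurable_fun setT S by exact: measurable_funD.
have mSc c : measurable [set t | S t <= c] by exact: measurable_set_le.
have mSd : measurable [set t | S t <= Ed t] by exact: measurable_set_le.
have mI a b : measurable [set t | a <= Ed t <= b] by exact: measurable_set_le_le.
have mlt : measurable [set t | Ed t < ERm] by exact: measurable_set_lt.
have mge : measurable [set t | EBm + ERm <= Ed t] by exact: measurable_set_le.
pose A1 := [set t | S t <= Ed t] `&` [set t | Ed t < ERm].
pose A2 := [set t | ERm <= Ed t <= EBm] `&` [set t | S t <= ERm].
have mA1 : measurable A1 by exact: measurableI.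
have mA2 : measurable A2 by exact: measurableI.
apply: (@le_trans _ _ (Pr P A1 + Pr P A2)); last first.
  rewrite -PrU//; last first.
    apply/seteqP; split => // t [[_ /= h] [/= /andP[h' _] _]].
    by move: (lt_le_trans h h'); rewrite ltxx.
  apply: le_Pr; [exact: measurableU|exact: measurable_efficiency_event|].
  move=> t; have := W0 t; have := Eb_gt0 t.
  move=> Et Wt A12.
  (* [Eb] and [W] are positive, so each is below S. On [A1], S <= Ed < ERm <= EBm; on [A2], S <= ERm
     <= Ed <= EBm. The four inequalities follow linearly. *)
  suff /= : [/\ Ed t <= EBm, Eb t <= EBm, W t <= ERm & Eb t + W t <= Ed t].
    by case.
  by case: A12 => [[]|[/andP[]]]; rewrite /= SE => *; split; lra.
rewrite lerD//; last by rewrite /P_low2 -ind.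
(* Independence, read backwards, turns the subtracted product into the probability of the
   intersection [A3]. *)
rewrite /P_low1 ge_max Pr_ge0/= lerBlDr -ind.
pose A3 := [set t | ERm <= Ed t <= EBm + ERm] `&` [set t | S t <= EBm + ERm].
have mA3 : measurable A3 by exact: measurableI.
have mA3U : measurable (A3 `|` [set t | EBm + ERm <= Ed t]) by exact: measurableU.
apply: (@le_trans _ _ (Pr P A1 + Pr P (A3 `|` [set t | EBm + ERm <= Ed t]))); last first.
  by rewrite lerD2l PrU_le.
apply: le_trans (PrU_le _ _ _ mA1 mA3U).
apply: le_Pr => //; first exact: measurableU.
(* The set {S <= Ed} is covered according to the position of [Ed] relative to [ERm] and [EBm + ERm];
   in the middle range S <= Ed < EBm + ERm gives [A3]. *)
move=> t /= h; have [h1|h1] := ltP (Ed t) ERm; first by left.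
right; have [h2|h2] := leP (EBm + ERm) (Ed t); first by right.
by left; split => /=; [rewrite h1 ltW|rewrite (le_trans h)// ltW].
Qed.

End efficiency_bound.

(** * Tilting one variable in the presence of an independent one *)

Section joint_tilt.
Context {d d1} {T : measurableType d} {T1 : measurableType d1} {R : realType}.
Context {P : probability T R} {Y : {mfun T >-> T1}} {s : {RV P >-> R}}.
Context {sigma : R}.

(** Integrate over [s] first: for each fixed value of [Y] the inner integral is an instance of the
    one-variable tilt. *)
Lemma lognormal_tilt_independent (c : R) (g : T1 * R -> \bar R) :
  independent_RV P Y s -> lognormal_shadowing s sigma -> 0 < sigma ->
  measurable_fun [set: T1 * R] g -> (forall z, 0 <= g z)%E ->
  (\int[P]_t ((s t `^ c)%:E * g (Y t, s t)) =
   (expR (c ^+ 2 * sigma ^+ 2 / 2))%:E *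
   \int[P]_t g (Y t, s t * expR (c * sigma ^+ 2))%R)%E.
Proof.
move=> ind hs s0 mg g0.
have mp : measurable_fun [set: T1 * R] (fun z => ((z.2 `^ c)%:E * g z)%E).
  apply: emeasurable_funM => //; apply/measurable_EFinP.
  exact: (@measurableT_comp _ _ _ _ _ _ (@powR R ^~ c)).
have mk : measurable_fun [set: T1 * R]
    (fun z => g (z.1, z.2 * expR (c * sigma ^+ 2))%R).
  apply: (measurableT_comp mg); apply: measurable_fun_pair => //.
  exact: measurable_funM.
rewrite (independent_integral _ _ _ ind _ mp)/=; last first.
  by move=> z; rewrite mule_ge0// lee_fin powR_ge0.
rewrite (independent_integral _ _ _ ind _ mk)//=.
(* Tonelli supplies the measurability of the inner integral, required to take the constant out of
   the outer one. *)
have mF : measurable_fun [set: T1]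
    (fun x => \int[P]_t g (x, s t * expR (c * sigma ^+ 2))%R)%E.
  have := @measurable_fun_fubini_tonelli_F _ _ _ _ _ (distribution P s)
    _ mk (fun z => g0 _).
  apply: eq_measurable_fun => x _; rewrite /fubini_F ge0_integral_distribution//.
  exact: (measurable_fun_pair2 _ mk).
rewrite -ge0_integralZl//; last by move=> x _; exact: integral_ge0.
apply: eq_integral => x _.
by rewrite (lognormal_tilt hs s0 c (fun z => g (x, z)))//; exact: measurable_fun_pair2.
Qed.

End joint_tilt.

(** * Consequences of the mutual independence of the four shadowings *)

Section mutual_independence.
Context {d} {T : measurableType d} {R : realType} {P : probability T R}.
Context {X Y Z V : {RV P >-> R}}.
Hypothesis ind : mutually_independent (tnth [tuple X; Y; Z; V]).

Lemma mutually_independent3 A B C :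
  measurable A -> measurable B -> measurable C ->
  P (X @^-1` A `&` Y @^-1` B `&` Z @^-1` C) =
  (P (X @^-1` A) * P (Y @^-1` B) * P (Z @^-1` C))%E.
Proof.
move=> mA mB mC.
(* The default [setT] is the set assigned to the fourth variable, whose factor is therefore 1. *)
pose F (i : 'I_4) := nth setT [:: A; B; C] i.
have mF i : measurable (F i).
  by rewrite /F; case: i => [[|[|[|[|//]]]] ?] /=.
have := ind [set: 'I_4]%SET F mF.
under eq_bigl do rewrite inE.
rewrite !big_ord_recl big_ord0 /= /F /= !(tnth_nth X)/=.
rewrite preimage_setT probability_setT !mule1 !muleA => <-.
congr (P _); apply/seteqP; split => t /=.
  move=> [[At Bt] Ct] i _; rewrite !(tnth_nth X).
  by case: i => [[|[|[|[|//]]]] ?] /=.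
move=> h; split; [split|].
- by have := h (@Ordinal 4 0 isT); rewrite (tnth_nth X)/=; apply; rewrite inE.
- by have := h (@Ordinal 4 1 isT); rewrite (tnth_nth X)/=; apply; rewrite inE.
- by have := h (@Ordinal 4 2 isT); rewrite (tnth_nth X)/=; apply; rewrite inE.
Qed.

(** Serves to separate [Ed] from the weighted sum of [Eb] and [Er]. *)
Lemma independent_first : independent_RV P X (pair_RV Y Z).
Proof. by apply: independent_pairr => A B C; exact: mutually_independent3. Qed.

(** Serves to tilt the relay shadowing while the other two are kept fixed. *)
Lemma independent_last : independent_RV P (pair_RV X Y) Z.
Proof.
have ind' : independent_RV P Z (pair_RV X Y).
  apply: independent_pairr => C A B mC mA mB.
  by rewrite -setIA setIC mutually_independent3// muleC muleA.
by move=> A B mA mB; rewrite setIC ind'// muleC.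
Qed.

End mutual_independence.

(** * Mean energy radiated by the relay *)

Section relay_mean.
Context {d} {T : measurableType d} {R : realType} {P : probability T R}.
Context {sd sb sr : {RV P >-> R}} {sigmar : R}.
Variables (Ed0 Eb0 Er0 EBm ERm : R).
Hypotheses (ind : independent_RV P (pair_RV sd sb) sr)
  (hsr : lognormal_shadowing sr sigmar) (sigmar_gt0 : 0 < sigmar)
  (Er0_ge0 : 0 <= Er0).

Let Ed := link_energy Ed0 sd.
Let Eb := link_energy Eb0 sb.

(** The event where the relay is used, as a set of shadowing values ((s_d, s_b), s_r): the radiated
    energy becomes a function of the pair and of s_r, as the tilt demands. *)
Definition relay_event (E : R) : set (R * R * R) :=
  let Ed' := link_energy Ed0 (fun z : R * R * R => z.1.1) in
  let Eb' := link_energy Eb0 (fun z : R * R * R => z.1.2) in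
  let Er' := link_energy E (fun z : R * R * R => z.2) in
  coverage_event Ed' Eb' Er' EBm ERm `|` efficiency_event Ed' Eb' Er' EBm ERm.

Lemma measurable_relay_event E : measurable (relay_event E).
Proof.
have m1 : measurable_fun setT (fun z : R * R * R => z.1.1).
  exact: (measurableT_comp measurable_fst measurable_fst).
have m2 : measurable_fun setT (fun z : R * R * R => z.1.2).
  exact: (measurableT_comp measurable_snd measurable_fst).
have m3 : measurable_fun setT (fun z : R * R * R => z.2) by exact: measurable_snd.
have m1' := measurable_link_energy Ed0 _ m1.
have m2' := measurable_link_energy Eb0 _ m2.
have m3' := measurable_link_energy E _ m3.
apply: measurableU.
  exact: measurable_coverage_event.
exact: measurable_efficiency_event.
Qed.

Lemma mean_relay_RF_energy :
  ('E_P[relay_RF_energy Ed Eb (link_energy Er0 sr) EBm ERm])%E =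
  ((Er0 * expR (sigmar ^+ 2 / 2))%:E *
   P (coverage_event Ed Eb (fun t => expR (sigmar ^+ 2) * link_energy Er0 sr t)%R
        EBm ERm `|`
      efficiency_event Ed Eb
        (fun t => expR (sigmar ^+ 2) * link_energy Er0 sr t)%R EBm ERm))%E.
Proof.
set W := fun t => expR _ * _; set V := _ `|` _.
have mI : measurable_fun setT (fun z => (Er0 * \1_(relay_event Er0) z)%:E).
  apply/measurable_EFinP/measurable_funM => //.
  by apply: measurable_indic; exact: measurable_relay_event.
rewrite unlock.
(* The factor 1 / s_r of the relay energy is the tilting weight, with c = -1; the constant [Er0] and
   the indicator remain. *)
transitivity (\int[P]_t ((sr t `^ (-1))%:E *
    (Er0 * \1_(relay_event Er0) (pair_RV sd sb t, sr t))%:E))%E.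
  apply: eq_integral => t _; rewrite -EFinM; congr EFin.
  rewrite powR_inv1; last exact/ltW/hsr.1.
  rewrite /relay_RF_energy patchE indicE.
  set b1 := (t \in _); set b2 := (_ \in _).
  have -> : b2 = b1 by apply/idP/idP; rewrite !inE.
  by case: b1; rewrite ?mulr1 ?mulr0// mulrC.
rewrite (lognormal_tilt_independent (-1) _ ind hsr sigmar_gt0 mI); last first.
  by move=> z; rewrite lee_fin mulr_ge0.
have mV : measurable V.
  have mEd : measurable_fun setT Ed by exact: measurable_link_energy.
  have mEb : measurable_fun setT Eb by exact: measurable_link_energy.
  have mW : measurable_fun setT W.
    by apply: measurable_funM => //; exact: measurable_link_energy.
  by apply: measurableU; [exact: measurable_coverage_event|
    exact: measurable_efficiency_event].
rewrite sqrrN expr1n mul1r mulN1r [in RHS]mulrC EFinM -muleA; congr (_ * _)%E.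
transitivity (\int[P]_t (Er0%:E * (\1_V t)%:E))%E.
  apply: eq_integral => t _; rewrite EFinM; congr (_ * _%:E)%E.
  rewrite !indicE; congr (_%:R); congr nat_of_bool.
  (* Multiplying s_r by exp(-sigma_r^2) multiplies the relay energy by exp(sigma_r^2), which gives
     [W]. *)
  have h : link_energy (R:=R) Er0 (fun z : R * R * R => z.2)
      (pair_RV sd sb t, sr t * expR (- sigmar ^+ 2)) = W t.
    by rewrite /W /link_energy /= invfM -expRN opprK [RHS]mulrC mulrA.
  apply/idP/idP; rewrite !inE /V /relay_event /coverage_event
    /efficiency_event /setU /setI /mkset h; exact.
rewrite ge0_integralZl//; last exact/measurable_EFinP/measurable_indic.
by rewrite integral_indic// setIT.
Qed.

End relay_mean.

(** * Positivity of the path-loss energies, rescaled links and mean shadowing *)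

Lemma two_powR_gt1 {R : realType} (x : R) : 0 < x -> 1 < 2 `^ x :> R.
Proof.
by move=> x0; rewrite /powR pnatr_eq0/= expR_gt1 mulr_gt0// ln_gt0// ltr1n.
Qed.

Lemma direct_energy0_gt0 {R : realType} (rate N gamma : R) :
  0 < rate -> 0 < N -> 0 < gamma -> 0 < direct_energy0 rate N gamma.
Proof.
by move=> r0 N0 g0; rewrite /direct_energy0 !mulr_gt0// subr_gt0 two_powR_gt1.
Qed.

Lemma hop_energy0_gt0 {R : realType} (rate N gamma : R) :
  0 < rate -> 0 < N -> 0 < gamma -> 0 < hop_energy0 rate N gamma.
Proof.
move=> r0 N0 g0; rewrite /hop_energy0 divr_gt0// !mulr_gt0// subr_gt0.
by rewrite two_powR_gt1// mulr_gt0.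
Qed.

(** Makes the tilted energy [W] a link energy again, so that the coverage and distribution formulas
    apply to it. *)
Lemma link_energy_scale {T : Type} {R : realType} (k E0 : R) (s : T -> R) :
  (fun t => k * link_energy E0 s t) = link_energy (k * E0) s.
Proof. by apply/funext => t; rewrite /link_energy mulrA. Qed.

(** The tilt with c = 1 applied to the constant function 1. *)
Lemma lognormal_mean {d} {T : measurableType d} {R : realType}
    {P : probability T R} {s : {RV P >-> R}} {sigma : R} :
  lognormal_shadowing s sigma -> 0 < sigma ->
  (\int[P]_t (s t)%:E = (expR (sigma ^+ 2 / 2))%:E)%E.
Proof.
move=> hs s0.
have := lognormal_tilt hs s0 1 (cst 1%E) (measurable_cst _) (fun=> lee01).
rewrite /= integral_cst//= mul1e probability_setT mule1 expr1n mul1r => <-.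
by apply: eq_integral => t _; rewrite mule1 powRr1//; exact/ltW/hs.1.
Qed.

(** * Factorization of probabilities by independence *)

Section coverage.
Context {d} {T : measurableType d} {R : realType} {P : probability T R}.
Context {sd sb sr sI : {RV P >-> R}}.
Hypothesis ind : mutually_independent (tnth [tuple sd; sb; sr; sI]).

Lemma measurable_link_energy_le (E0 E : R) :
  measurable [set x | link_energy E0 id x <= E].
Proof.
by apply: measurable_set_le => //; exact: (measurable_link_energy _ _ (@measurable_id _ _ _)).
Qed.

Lemma Pr_coverage_event (Ed0 Eb0 Er0 EBm ERm : R) :
  Pr P (coverage_event (link_energy Ed0 sd) (link_energy Eb0 sb)
    (link_energy Er0 sr) EBm ERm) =
  Pr P [set t | link_energy Ed0 sd t > EBm] *
  Pr P [set t | link_energy Eb0 sb t <= EBm] *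
  Pr P [set t | link_energy Er0 sr t <= ERm].
Proof.
have mlt : measurable [set x | EBm < link_energy Ed0 id x].
  by apply: measurable_set_lt => //; exact: (measurable_link_energy _ _ (@measurable_id _ _ _)).
have mle E0 E := measurable_link_energy_le E0 E.
have m1 : measurable [set t | EBm < link_energy Ed0 sd t].
  exact: (measurable_funPTI sd mlt).
have m2 : measurable [set t | link_energy Eb0 sb t <= EBm].
  exact: (measurable_funPTI sb (mle _ _)).
have m3 : measurable [set t | link_energy Er0 sr t <= ERm].
  exact: (measurable_funPTI sr (mle _ _)).
apply: EFin_inj; rewrite !EFinM !EFin_Pr//; last first.
  by apply: measurableI => //; exact: measurableI.
exact: (mutually_independent3 ind _ _ _ mlt (mle Eb0 EBm) (mle Er0 ERm)).
Qed.

Lemma Pr_direct_weighted_sum (Ed0 Eb0 Er0 sigma a b c : R) :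
  let Ed := link_energy Ed0 sd in
  let S := weighted_sum (link_energy Eb0 sb) (link_energy Er0 sr) sigma in
  Pr P ([set t | a <= Ed t <= b] `&` [set t | S t <= c]) =
  Pr P [set t | a <= Ed t <= b] * Pr P [set t | S t <= c].
Proof.
move=> Ed S.
have mA : measurable [set x | a <= link_energy Ed0 id x <= b].
  by apply: measurable_set_le_le; exact: (measurable_link_energy _ _ (@measurable_id _ _ _)).
have mB : measurable [set z : R * R | weighted_sum (link_energy Eb0 fst)
    (link_energy Er0 snd) sigma z <= c].
  apply: measurable_set_le => //; apply: measurable_funD.
    exact: measurable_link_energy.
  by apply: measurable_funM => //; exact: measurable_link_energy.
have m1 : measurable [set t | a <= Ed t <= b] by exact: (measurable_funPTI sd mA).
have m2 : measurable [set t | S t <= c].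
  exact: (measurable_funPTI (pair_RV sb sr) mB).
apply: EFin_inj; rewrite !EFinM !EFin_Pr//; last exact: measurableI.
exact: (independent_first ind _ _ mA mB).
Qed.

End coverage.

(** * Lower bound on the average interference *)

Theorem mainTheorem3 (d : measure_display) (T : measurableType d) (R : realType)
    (P : probability T R)
    (sd sb sr sI : {RV P >-> R})
    (sigmad sigmab sigmar sigmaI : R)
    (rate N gammad gammab gammar : R)
    (KI dI alphaI : R)
    (EBm ERm : R)
    (hsigmad : 0 < sigmad) (hsigmab : 0 < sigmab)
    (hsigmar : 0 < sigmar) (hsigmaI : 0 < sigmaI)
    (hrate : 0 < rate) (hN : 0 < N)
    (hgammad : 0 < gammad) (hgammab : 0 < gammab) (hgammar : 0 < gammar)
    (hKI : 0 < KI) (hdI : 0 < dI)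
    (hERm : 0 < ERm) (hERB : ERm <= EBm)
    (hsd : lognormal_shadowing sd sigmad)
    (hsb : lognormal_shadowing sb sigmab)
    (hsr : lognormal_shadowing sr sigmar)
    (hsI : lognormal_shadowing sI sigmaI)
    (hind : mutually_independent (tnth [tuple sd; sb; sr; sI])) :
  let Ed := link_energy (direct_energy0 rate N gammad) sd in
  let Eb := link_energy (hop_energy0 rate N gammab) sb in
  let Er := link_energy (hop_energy0 rate N gammar) sr in
  let mur := ln (hop_energy0 rate N gammar) in
  let I := average_interference P (relay_RF_energy Ed Eb Er EBm ERm) sI
             (path_loss KI dI alphaI) in
  let Ihat := mean_RF_lower P Ed Eb Er mur sigmar EBm ERm *
              (expR (sigmaI ^+ 2 / 2) / (KI * dI `^ alphaI)) in
  Pr P (coverage_event Ed Eb Er EBm ERm) =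
    Pr P [set t | Ed t > EBm] * Pr P [set t | Eb t <= EBm] *
    Pr P [set t | Er t <= ERm]
  /\ (Ihat%:E <= I)%E.
Proof.
move=> Ed Eb Er mur I Ihat.
split; first exact: (Pr_coverage_event hind).
have Ed0 := direct_energy0_gt0 rate N gammad hrate hN hgammad.
have Eb0 := hop_energy0_gt0 rate N gammab hrate hN hgammab.
have Er0 := hop_energy0_gt0 rate N gammar hrate hN hgammar.
have mEd : measurable_fun setT Ed by exact: measurable_link_energy.
have mEb : measurable_fun setT Eb by exact: measurable_link_energy.
have mEr : measurable_fun setT Er by exact: measurable_link_energy.
have hEB : 0 < EBm by exact: lt_le_trans hERB.
pose K : R := hop_energy0 rate N gammar * expR (sigmar ^+ 2 / 2).
have K0 : 0 < K by rewrite mulr_gt0 ?expR_gt0.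
have KE : expR (mur + sigmar ^+ 2 / 2) = K by rewrite expRD lnK ?posrE.
pose W t := expR (sigmar ^+ 2) * Er t.
have mW : measurable_fun setT W by exact: measurable_funM.
have WE : W = link_energy (expR (sigmar ^+ 2) * hop_energy0 rate N gammar) sr.
  exact: link_energy_scale.
have mean : ('E_P[relay_RF_energy Ed Eb Er EBm ERm])%E =
    (K * (Pr P (coverage_event Ed Eb W EBm ERm) +
          Pr P (efficiency_event Ed Eb W EBm ERm)))%:E.
  rewrite /Er (mean_relay_RF_energy _ _ _ _ _ (independent_last hind) hsr)//; last exact: ltW.
  rewrite [RHS]EFinM; congr (_ * _)%E; rewrite -PrU ?EFin_Pr//.
  - by apply: measurableU; [exact: measurable_coverage_event|
      exact: measurable_efficiency_event].
  - exact: measurable_coverage_event.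
  - exact: measurable_efficiency_event.
  - exact: coverage_efficiency_disjoint.
have gamma0 : 0 < path_loss KI dI alphaI by rewrite mulr_gt0// powR_gt0.
(* This value of the interference is exact; the only estimate made afterwards concerns the
   efficiency event. *)
have IE : I = (K * (Pr P (coverage_event Ed Eb W EBm ERm) +
          Pr P (efficiency_event Ed Eb W EBm ERm)) *
    (expR (sigmaI ^+ 2 / 2) / (KI * dI `^ alphaI)))%:E.
  rewrite /I /average_interference mean.
  set m := K * _.
  have m0 : 0 <= m by rewrite mulr_ge0 ?addr_ge0 ?Pr_ge0// ltW.
  transitivity (\int[P]_t ((m / path_loss KI dI alphaI)%:E * (sI t)%:E))%E.
    by apply: eq_integral => t _; rewrite -!EFinM; congr EFin; rewrite mulrCA mulrC.
  rewrite ge0_integralZl//; last 3 first.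
  - exact/measurable_EFinP.
  - by move=> t _; rewrite lee_fin ltW//; exact: hsI.1.
  - by rewrite lee_fin divr_ge0// ltW.
  rewrite (lognormal_mean hsI hsigmaI) -EFinM /path_loss; congr EFin.
  by rewrite mulrAC -mulrA.
rewrite IE lee_fin /Ihat ler_pM2r; last by rewrite divr_gt0 ?expR_gt0.
rewrite /mean_RF_lower /E_low KE [leRHS]mulrDr lerD//; last first.
  rewrite ler_pM2l//; apply: efficiency_event_lower_bound => //.
  - by move=> t; rewrite divr_gt0//; exact: hsb.1.
  - by move=> t; rewrite divr_gt0//; exact: hsr.1.
  - by move=> a b c; exact: (Pr_direct_weighted_sum hind).
(* Coverage term: passing from [Er] to [W] adds sigma_r^2 to the log-mean, which shifts the argument
   of [Phi] by -sigma_r and produces the numerator of g. *)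
rewrite WE !(Pr_coverage_event hind) /g_mean KE.
have kE0 : 0 < expR (sigmar ^+ 2) * hop_energy0 rate N gammar.
  by rewrite mulr_gt0 ?expR_gt0.
rewrite !(lognormal_link_cdf hsr hsigmar)// lnM ?posrE ?expR_gt0// expRK -/mur.
have -> : (ln ERm - (sigmar ^+ 2 + mur)) / sigmar =
    - sigmar + (ln ERm - mur) / sigmar by field; rewrite gt_eqF.
set p := Pr _ _ * _; set F0 := Phi _; set F1 := Phi _.
have p0 : 0 <= p by rewrite mulr_ge0 ?Pr_ge0.
have F10 : 0 <= F1 by exact: fine_ge0.
(* [F0] is both the probability that [Er <= ERm], a factor of P_CR, and the denominator of g. If it
   is 0 the left side is 0 and the right side nonnegative; otherwise it cancels and equality
   holds. *)
have [->|F0n] := eqVneq F0 0.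
  rewrite mulr0 mul0r; apply: mulr_ge0; first exact: ltW.
  exact: mulr_ge0.
by rewrite le_eqVlt; apply/orP; left; apply/eqP; field.
Qed.
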